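(* Let $V$ be a set, $X\subset V$ a subset, and $\varphi:V\to X$ a map with $\varphi(x)=x$ for every $x\in X$. Choose a total ordering $\le$ on $X$ with a minimal element $0=0_X$, and view $X$ as the bipotent monoid $(X,+)$ with $x_1+x_2=\max(x_1,x_2)$. Define a composition $+$ on $V$ by $$v_1+v_2=\begin{cases} v_2 & \text{if }\varphi(v_1)<\varphi(v_2),\\ v_1 & \text{if }\varphi(v_1)>\varphi(v_2),\\ \varphi(v_1) & \text{if }\varphi(v_1)=\varphi(v_2).\end{cases}$$ Then: (i) $(V,+)$ is an upper bound additive monoid and $\varphi:V\to X$ is a special bipotent retraction. (ii) Every fiber $\varphi^{-1}(x)$, $x\in X$, is convex with respect to the partial ordering $\le_V$; in particular $\varphi^{-1}(0)=\{0\}$. (iii) Let $v\in V$, $x\in X$. If $\varphi(v)\le\varphi(x)=x$, then $v+x=x$. If $\varphi(v)>\varphi(x)$, then $v+x=v$. (iv) $v+v=\varphi(v)$ for every $v\in V$. Thus the bipotent submonoid $X$ of $(V,+)$ is uniquely determined by $(V,+)$ (if $\psi:V\to X'$ is a special bipotent retraction of the same monoid $(V,+)$, then $X'=X$). If $v_1+v_1=v_2+v_2$, then $v_1+v_1=v_1+v_2$.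
   Context: An additive monoid is a commutative monoid written additively with neutral element $0$. For an additive monoid $V$, the quasiordering $\le_V$ is defined by $x\le_V y\Leftrightarrow \exists z\in V: x+z=y$. $V$ is called upper bound if $\le_V$ is antisymmetric (hence a partial ordering). A subset $S\subset V$ is convex if $s_1\le_V s\le_V s_2$ with $s_1,s_2\in S$, $s\in V$ implies $s\in S$. An additive monoid $(X,+)$ is bipotent if $x_1+x_2\in\{x_1,x_2\}$ for all $x_1,x_2\in X$. A bipotent retraction of an additive monoid $(V,+)$ is a monoid homomorphism $\varphi:(V,+)\to(X,+)$ to a bipotent submonoid $X$ of $V$ with $\varphi(x)=x$ for all $x\in X$. It is called special if for all $v_1,v_2\in V$: $v_1+v_2\in\{v_1,v_2\}$ if $\varphi(v_1)\ne\varphi(v_2)$, while $v_1+v_2=\varphi(v_1)$ if $\varphi(v_1)=\varphi(v_2)$.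
   Formalization: The formal theorem additionally assumes that φ(v)=0 implies v=0; without it the claim fails (V={0,a}, X={0}, φ constant gives a+0=0, so 0 is not neutral), and part (i) itself forces it. *)

(* Defs.v *)
From mathcomp Require Import all_boot.
From mathcomp Require Import boolp classical_sets.

Set Implicit Arguments.
Unset Strict Implicit.
Unset Printing Implicit Defensive.

Local Open Scope classical_set_scope.

Record additive_monoid (V : Type) (add : V -> V -> V) (zero : V) : Prop :=
  AdditiveMonoid {
    amonoidA : associative add;
    amonoidC : commutative add;
    amonoid0 : left_id zero add }.

Definition le_add (V : Type) (add : V -> V -> V) (x y : V) : Prop :=
  exists z, add x z = y.

Definition upper_bound_monoid (V : Type) (add : V -> V -> V) (zero : V) : Prop :=
  additive_monoid add zero /\
  forall x y, le_add add x y -> le_add add y x -> x = y.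

Definition convex_subset (V : Type) (add : V -> V -> V) (S : set V) : Prop :=
  forall s1 s s2, S s1 -> S s2 -> le_add add s1 s -> le_add add s s2 -> S s.

Definition submonoid (V : Type) (add : V -> V -> V) (zero : V) (X : set V) : Prop :=
  X zero /\ forall x1 x2, X x1 -> X x2 -> X (add x1 x2).

Definition bipotent (V : Type) (add : V -> V -> V) (X : set V) : Prop :=
  forall x1 x2, X x1 -> X x2 -> add x1 x2 = x1 \/ add x1 x2 = x2.

Record bipotent_retraction (V : Type) (add : V -> V -> V) (zero : V)
    (X : set V) (phi : V -> X) : Prop := BipotentRetraction {
  bretr_monoid : additive_monoid add zero;
  bretr_sub : submonoid add zero X;
  bretr_bip : bipotent add X;
  bretr_add : forall v1 v2, val (phi (add v1 v2)) = add (val (phi v1)) (val (phi v2));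
  bretr_zero : val (phi zero) = zero;
  bretr_id : forall x : X, phi (val x) = x }.

Record special_bipotent_retraction (V : Type) (add : V -> V -> V) (zero : V)
    (X : set V) (phi : V -> X) : Prop := SpecialBipotentRetraction {
  sbretr_bretr : bipotent_retraction add zero phi;
  sbretr_neq : forall v1 v2, phi v1 <> phi v2 -> add v1 v2 = v1 \/ add v1 v2 = v2;
  sbretr_eq : forall v1 v2, phi v1 = phi v2 -> add v1 v2 = val (phi v1) }.

Definition total_ordering (T : Type) (le : rel T) : Prop :=
  [/\ reflexive le, antisymmetric le, transitive le & total le].

Definition strict (T : Type) (le : rel T) (x y : T) : bool :=
  `[< x <> y >] && le x y.

Definition max_of (T : Type) (le : rel T) (x y : T) : T :=
  if le x y then y else x.

(* When [le] is a total ordering, the last branch is the case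
   [phi v1 = phi v2]. *)
Definition retract_add (V : Type) (X : set V) (phi : V -> X) (le : rel X)
    (v1 v2 : V) : V :=
  if strict le (phi v1) (phi v2) then v2
  else if strict le (phi v2) (phi v1) then v1
  else val (phi v1).

(* If [zero] is neutral for [retract_add], then the fiber of [phi] over [zero]
   is trivial. This does not follow from [phi] being a retraction onto [X]
   (take V = {0, a}, X = {0}), so it has to be assumed of [phi]. *)
Lemma retract_add_fiber0 (V : Type) (X : set V) (phi : V -> X) (le : rel X)
    (zero : X) :
  (forall x : X, phi (val x) = x) ->
  left_id (val zero) (retract_add phi le) ->
  forall v, phi v = zero -> v = val zero.
Proof.
move=> phiK add0 v phiv; rewrite -[LHS]add0 /retract_add phiK phiv /strict.
by case: asboolP.
Qed.

(* Main.v *)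
(* The map [phi] turns the addition into [max], so [u <=_V v] forces
   [phi u <= phi v]; and inside a fiber the only element strictly above a given
   one is [phi u] itself, whence antisymmetry. Since [v + v = phi v], the retract
   [X] is the set of idempotents of [V], hence depends on the monoid only. *)
Require Import Defs.
From mathcomp Require Import all_boot.
From mathcomp Require Import boolp classical_sets.

Set Implicit Arguments.
Unset Strict Implicit.
Unset Printing Implicit Defensive.

Local Open Scope classical_set_scope.

(** Trades membership in [X] for an element of the subtype, where [phi] takes its values and [le]
    compares. *)
Lemma set_typeP (V : Type) (X : set V) (v : V) : X v <-> exists x : X, v = val x.
Proof.
split=> [Xv|[x ->]]; last exact: set_valP.
by exists (SigSub (mem_set Xv)).
Qed.

Section StrictOrder.
Variables (T : Type) (le : rel T).
Hypothesis le_total : total_ordering le.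

Lemma strictP x y : reflect (x <> y /\ le x y) (strict le x y).
Proof. by apply: (iffP andP) => -[/asboolP]. Qed.

Lemma strict_irr x : strict le x x = false.
Proof. by apply/strictP => -[]. Qed.

Lemma strict_le_trans x y z : strict le x y -> le y z -> strict le x z.
Proof.
have [_ asym trans _] := le_total; move=> /strictP[xDy xy] yz.
apply/strictP; split; last exact: trans yz.
by move=> xz; apply/xDy/asym; rewrite xy xz.
Qed.

Lemma strict_trichotomy x y : [\/ strict le x y, strict le y x | x = y].
Proof.
have [_ _ _ tot] := le_total; have [->|xDy] := pselect (x = y).
  exact: Or33.
case/orP: (tot x y) => ?; [apply: Or31|apply: Or32]; apply/strictP; split=> //.
exact: nesym.
Qed.

Lemma strict_asym x y : strict le x y -> strict le y x = false.
Proof.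
move=> xy; apply/negP => /strictP[_] /(strict_le_trans xy).
by rewrite strict_irr.
Qed.

Lemma le_strict x y : le x y -> strict le x y \/ x = y.
Proof.
by move=> xy; have [->|xDy] := pselect (x = y); [right|left; apply/strictP].
Qed.

Lemma max_of_strictl x y : strict le x y -> max_of le x y = y.
Proof. by rewrite /max_of => /strictP[_ ->]. Qed.

Lemma max_of_strictr x y : strict le y x -> max_of le x y = x.
Proof.
(* [max_of] tests [le x y]; together with [y] strictly below [x] this would put [y] strictly below
   itself. *)
by rewrite /max_of; case: ifP => // xy /strict_le_trans/(_ xy); rewrite strict_irr.
Qed.

Lemma max_of_id x : max_of le x x = x.
Proof. by rewrite /max_of; case: ifP. Qed.

Lemma le_maxl x y : le x (max_of le x y).
Proof. by have [refl _ _ _] := le_total; rewrite /max_of; case: ifP. Qed.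

End StrictOrder.

Section RetractAdd.
Variables (V : Type) (X : set V) (phi : V -> X) (le : rel X) (zero : X).
Hypothesis phiK : forall x : X, phi (val x) = x.
Hypothesis le_total : total_ordering le.
Hypothesis zero_min : forall x : X, le zero x.
Hypothesis phi_fiber0 : forall v : V, phi v = zero -> v = val zero.

Local Notation add := (retract_add phi le).
Local Notation lt := (strict le).

Lemma retract_add_ltl u v : lt (phi u) (phi v) -> add u v = v.
Proof. by rewrite /retract_add => ->. Qed.

Lemma retract_add_ltr u v : lt (phi v) (phi u) -> add u v = u.
Proof. by move=> vu; rewrite /retract_add vu strict_asym. Qed.

Lemma retract_add_eq u v : phi u = phi v -> add u v = val (phi u).
Proof. by rewrite /retract_add => ->; rewrite strict_irr. Qed.

(** Off ties the sum is the summand with the larger image; on a tie it is [val (phi u)], which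
    [phiK] puts back in the same fiber. *)
Lemma phi_retract_add u v : phi (add u v) = max_of le (phi u) (phi v).
Proof.
have [uv|vu|uv] := strict_trichotomy le_total (phi u) (phi v).
- by rewrite retract_add_ltl ?max_of_strictl.
- by rewrite retract_add_ltr ?max_of_strictr.
- by rewrite retract_add_eq // phiK uv max_of_id.
Qed.

Lemma retract_add_val x y : add (val x) (val y) = val (max_of le x y).
Proof.
have [xy|yx|->] := strict_trichotomy le_total x y.
- by rewrite retract_add_ltl ?max_of_strictl ?phiK.
- by rewrite retract_add_ltr ?max_of_strictr ?phiK.
- by rewrite retract_add_eq // phiK max_of_id.
Qed.

Lemma retract_addC : commutative add.
Proof.
move=> u v; have [uv|vu|uv] := strict_trichotomy le_total (phi u) (phi v).
- by rewrite retract_add_ltl // retract_add_ltr.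
- by rewrite retract_add_ltr // retract_add_ltl.
- by rewrite !retract_add_eq // uv.
Qed.

Lemma retract_addA : associative add.
Proof.
move=> u v w; have [uv|vu|uv] := strict_trichotomy le_total (phi u) (phi v).
(* Here [u] is absorbed on both sides, since [phi (add v w)] is at least [phi v]. *)
- rewrite (retract_add_ltl uv) retract_add_ltl // phi_retract_add.
  exact: strict_le_trans (le_maxl _ _ _).
(* Now [v] is absorbed by [u], so the right side is [add u w]; if [w] does not exceed [v] in the
   order of images, both sides are [u]. *)
- rewrite (retract_add_ltr vu).
  have [vw|wv|vw] := strict_trichotomy le_total (phi v) (phi w).
  + by rewrite (retract_add_ltl vw).
  + rewrite (retract_add_ltr wv) !retract_add_ltr //.
    by apply: (strict_le_trans le_total wv); case/strictP: vu.
  + by rewrite (retract_add_eq vw) !retract_add_ltr ?phiK // -vw.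
(* On a tie of [u] and [v], both sides are [w] if [phi w] is larger, and [val (phi u)] otherwise. *)
- rewrite (retract_add_eq uv).
  have [vw|wv|vw] := strict_trichotomy le_total (phi v) (phi w).
  + by rewrite (retract_add_ltl vw) !retract_add_ltl ?phiK ?uv.
  + by rewrite (retract_add_ltr wv) (retract_add_eq uv) retract_add_ltr // phiK uv.
  + by rewrite (retract_add_eq vw) !retract_add_eq ?phiK ?uv.
Qed.

Lemma retract_add0 : left_id (val zero) add.
Proof.
move=> v; have [zv|vE] := le_strict (zero_min (phi v)).
  by rewrite retract_add_ltl ?phiK.
(* On a tie with [zero] the sum is [val zero], so neutrality needs the fiber over [zero] to be
   trivial. *)
by rewrite retract_add_eq phiK // -(phi_fiber0 (esym vE)).
Qed.

Lemma retract_add_monoid : additive_monoid add (val zero).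
Proof. by split; [exact: retract_addA|exact: retract_addC|exact: retract_add0]. Qed.

Lemma le_add_phi u v : le_add add u v -> le (phi u) (phi v).
Proof. by move=> [w <-]; rewrite phi_retract_add le_maxl. Qed.

Lemma le_phi_anti u v : le (phi u) (phi v) -> le (phi v) (phi u) -> phi u = phi v.
Proof. by have [_ asym _ _] := le_total; move=> uv vu; apply: asym; rewrite uv. Qed.

(** A summand with smaller image leaves [u] unchanged, one in the same fiber gives [val (phi u)],
    and one with larger image would leave the fiber. *)
Lemma le_add_fiber u v : le_add add u v -> phi u = phi v -> v = u \/ v = val (phi u).
Proof.
move=> [w <-]; have [uw|wu|uw] := strict_trichotomy le_total (phi u) (phi w).
- by rewrite retract_add_ltl // => uwE; rewrite uwE strict_irr in uw.
- by left; rewrite retract_add_ltr.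
- by right; rewrite retract_add_eq.
Qed.

Lemma le_add_anti u v : le_add add u v -> le_add add v u -> u = v.
Proof.
move=> uv vu; have phiE := le_phi_anti (le_add_phi uv) (le_add_phi vu).
(* Unless [u = v] is immediate, both are the retract of their common fiber. *)
have [//|vE] := le_add_fiber uv phiE; have [//|->] := le_add_fiber vu (esym phiE).
by rewrite {2}vE phiE.
Qed.

(** Since [phi] is monotone, [phi s] is squeezed between [x] and [x]. *)
Lemma retract_add_convex x : convex_subset add (phi @^-1` [set x]).
Proof.
move=> s1 s s2 /= s1x s2x /le_add_phi s1s /le_add_phi ss2.
by rewrite -s1x; apply/esym/le_phi_anti => //; rewrite s1x -s2x.
Qed.

Lemma retract_add_special : special_bipotent_retraction add (val zero) phi.
Proof.
split=> [|u v uDv|]; last exact: retract_add_eq.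
  split=> [|||u v||]; [exact: retract_add_monoid| | | | |exact: phiK].
  - split; first exact: set_valP.
    move=> _ _ /set_typeP[x ->] /set_typeP[y ->].
    by rewrite retract_add_val; exact: set_valP.
  - move=> _ _ /set_typeP[x ->] /set_typeP[y ->].
    by rewrite retract_add_val /max_of; case: ifP; [right|left].
  - by rewrite retract_add_val phi_retract_add.
  - by rewrite phiK.
have [uv|vu|//] := strict_trichotomy le_total (phi u) (phi v).
- by right; exact: retract_add_ltl.
- by left; exact: retract_add_ltr.
Qed.

End RetractAdd.

(** The tie rule with equal arguments gives [add v v = val (phi v)], which is [v] exactly when [v]
    lies in [X]. *)
Lemma special_retraction_idem (V : Type) (add : V -> V -> V) (zero : V)
    (X : set V) (phi : V -> X) :
  special_bipotent_retraction add zero phi -> X = [set v | add v v = v].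
Proof.
move=> -[[_ _ _ _ _ phiK] _ addvv]; apply/seteqP; split=> v /=.
  by move=> /set_typeP[x ->]; rewrite addvv // phiK.
by rewrite addvv // => <-; exact: set_valP.
Qed.

Theorem theorem11p7 (V : Type) (X : set V) (phi : V -> X)
    (phiK : forall x : X, phi (val x) = x)
    (le : rel X) (le_total : total_ordering le)
    (zero : X) (zero_min : forall x : X, le zero x)
    (phi_fiber0 : forall v : V, phi v = zero -> v = val zero) :
  let add := retract_add phi le in
  let lt := strict le in
  (* (i) *)
  [/\ upper_bound_monoid add (val zero),
      special_bipotent_retraction add (val zero) phi
    & forall x1 x2 : X, add (val x1) (val x2) = val (max_of le x1 x2)]
  /\
  (* (ii) *)
  ((forall x : X, convex_subset add (phi @^-1` [set x])) /\
   phi @^-1` [set zero] = [set val zero])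
  /\
  (* (iii) *)
  (forall (v : V) (x : X),
     (le (phi v) (phi (val x)) -> phi (val x) = x -> add v (val x) = val x) /\
     (lt (phi (val x)) (phi v) -> add v (val x) = v))
  /\
  (* (iv) *)
  [/\ forall v : V, add v v = val (phi v),
      forall (X' : set V) (psi : V -> X'),
        special_bipotent_retraction add (val zero) psi -> X' = X
    & forall v1 v2 : V, add v1 v1 = add v2 v2 -> add v1 v1 = add v1 v2].
Proof.
move=> add lt; have special := retract_add_special phiK le_total zero_min phi_fiber0.
have addvv v : add v v = val (phi v) by exact: retract_add_eq.
split; [split|split; [split|split; [move=> v x; split|split]]].
- split; first exact: retract_add_monoid.
  by move=> u v; exact: le_add_anti.
- exact: special.
- exact: retract_add_val.
- exact: retract_add_convex.
- by apply/seteqP; split=> v /=; [exact: phi_fiber0|move=> ->; rewrite phiK].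
- move=> vx _; have [vlt|vE] := le_strict vx; first exact: retract_add_ltl.
  by rewrite /add retract_add_eq // vE phiK.
- exact: retract_add_ltr.
- exact: addvv.
- move=> X' psi special'; transitivity [set v | add v v = v].
    exact: special_retraction_idem special'.
  exact: esym (special_retraction_idem special).
(* Equal doubles mean equal images under [phi], so the tie rule also computes [add v1 v2]. *)
- move=> v1 v2; rewrite !addvv => /val_inj v12.
  by rewrite /add retract_add_eq.
Qed.
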